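(* For a positive integer $n$, let $\mathcal{A}_n=\{(x,y)\in\mathbb{Z}^2: 1\le x,y\le n\}$. A closed broken line supported on $\mathcal{A}_n$ is a cyclic ordering $L=(a_1,a_2,\ldots,a_{n^2})$ of all $n^2$ points of $\mathcal{A}_n$ (each point used exactly once), with $a_{n^2+1}=a_1$, whose edges $[a_i,a_{i+1}]$, $1\le i\le n^2$, are non-self-intersecting: two distinct edges meet only if they are consecutive, and then only at their shared endpoint. Straight angles are allowed, i.e. three consecutive vertices may be collinear. Define $s(L)=\sum_{i=1}^{n^2}|a_{i+1}-a_i|^2$, where $|\cdot|$ is the Euclidean norm, and let $a(n)$ be the maximum of $s(L)$ over all such $L$. Define $\alpha(n)=\frac{8}{27}n^4-\frac{464}{729}n^3+r(n)$, where $r(n)$ is determined by the residue of $n$ modulo $9$: - if $n\equiv 0 \pmod 9$: $r(n)=-\frac{4}{3}n^2+6n-2$; - if $n\equiv 1 \pmod 9$: $r(n)=-\frac{292}{243}n^2+\frac{922}{243}n-\frac{1642}{729}$; - if $n\equiv 2 \pmod 9$: $r(n)=-\frac{308}{243}n^2+\frac{946}{243}n-\frac{1724}{729}$; - if $n\equiv 3 \pmod 9$: $r(n)=-\frac{4}{3}n^2+\frac{158}{27}n-\frac{64}{27}$; - if $n\equiv 4 \pmod 9$: $r(n)=-\frac{292}{243}n^2+\frac{886}{243}n-\frac{1804}{729}$; - if $n\equiv 5 \pmod 9$: $r(n)=-\frac{308}{243}n^2+\frac{874}{243}n-\frac{1400}{729}$; - if $n\equiv 6 \pmod 9$: $r(n)=-\frac{4}{3}n^2+\frac{158}{27}n-\frac{44}{27}$;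 - if $n\equiv 7 \pmod 9$: $r(n)=-\frac{292}{243}n^2+\frac{886}{243}n-\frac{1264}{729}$; - if $n\equiv 8 \pmod 9$: $r(n)=-\frac{308}{243}n^2+\frac{946}{243}n-\frac{1292}{729}$. Then for every integer $n\ge 9$, $a(n)\ge \alpha(n)$.
   Context: Edges are closed straight segments in $\mathbb{R}^2$ between the listed lattice points. The broken line need not be convex. *)

(* Defs.v *)
From mathcomp Require Import all_boot all_order all_algebra.
From mathcomp Require Import boolp classical_sets reals.
Set Implicit Arguments.
Unset Strict Implicit.
Unset Printing Implicit Defensive.
Import Order.TTheory GRing.Theory Num.Theory.
Local Open Scope ring_scope.
Local Open Scope classical_set_scope.

Section BrokenLines.
Variable R : realType.

(* MathComp's norm on [R * R] is the sup norm, hence this definition. *)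
Definition euclidean_norm (v : R * R) : R := Num.sqrt (v.1 ^+ 2 + v.2 ^+ 2).

Definition segment (a b : R * R) : set (R * R) :=
  [set ((1 - t) * a.1 + t * b.1, (1 - t) * a.2 + t * b.2)
     | t in [set t : R | 0 <= t <= 1]].

Section Grid.
Variable n : nat.

(* 'I_n is {0, ..., n-1}, so the coordinates are shifted to range over
   {1, ..., n}. *)
Definition lattice_point (p : 'I_n * 'I_n) : R * R := (p.1.+1%:R, p.2.+1%:R).

(* A cyclic ordering is represented by any of its enumerations, with indices
   taken cyclically through [ordS]; closedness, simplicity and the sum below do
   not depend on the starting point. *)
Definition ordering := {ffun 'I_(n ^ 2) -> 'I_n * 'I_n}.

Definition vertex (L : ordering) (i : 'I_(n ^ 2)) : R * R :=
  lattice_point (L i).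

Definition edge (L : ordering) (i : 'I_(n ^ 2)) : set (R * R) :=
  segment (vertex L i) (vertex L (ordS i)).

Definition non_self_intersecting (L : ordering) : Prop :=
  forall (i j : 'I_(n ^ 2)) (p : R * R), i <> j -> edge L i p -> edge L j p ->
    (j = ordS i /\ p = vertex L j) \/ (i = ordS j /\ p = vertex L i).

Definition closed_broken_line (L : ordering) : Prop :=
  bijective L /\ non_self_intersecting L.

Definition sum_sq_lengths (L : ordering) : R :=
  \sum_(i < n ^ 2) euclidean_norm (vertex L (ordS i) - vertex L i) ^+ 2.

(* All the sums are nonnegative, so the default value 0 of the big maximum only
   matters when there is no closed broken line. *)
Definition max_sum_sq_lengths : R :=
  \big[Num.max/0]_(L : ordering | `[< closed_broken_line L >])
    sum_sq_lengths L.

Definition alpha_residue : R :=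
  let x : R := n%:R in
  match (n %% 9)%N with
  | 0 => - (4 / 3) * x ^+ 2 + 6 * x - 2
  | 1 => - (292 / 243) * x ^+ 2 + 922 / 243 * x - 1642 / 729
  | 2 => - (308 / 243) * x ^+ 2 + 946 / 243 * x - 1724 / 729
  | 3 => - (4 / 3) * x ^+ 2 + 158 / 27 * x - 64 / 27
  | 4 => - (292 / 243) * x ^+ 2 + 886 / 243 * x - 1804 / 729
  | 5 => - (308 / 243) * x ^+ 2 + 874 / 243 * x - 1400 / 729
  | 6 => - (4 / 3) * x ^+ 2 + 158 / 27 * x - 44 / 27
  | 7 => - (292 / 243) * x ^+ 2 + 886 / 243 * x - 1264 / 729
  | _ (* 8 *) => - (308 / 243) * x ^+ 2 + 946 / 243 * x - 1292 / 729
  end.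

Definition alpha : R :=
  8 / 27 * n%:R ^+ 4 - 464 / 729 * n%:R ^+ 3 + alpha_residue.

End Grid.
End BrokenLines.

Arguments max_sum_sq_lengths R n : clear implicits.
Arguments alpha R n : clear implicits.

(* Main.v *)
(** Number the diagonals of the grid from the top left corner to the bottom
right one.  A snake visits them in this order: between two consecutive
diagonals it zigzags from the lower third of the first one to the upper third
of the second one, with edges about two thirds of the diagonal long, and it
crosses the middle third of each diagonal with unit diagonal steps.  A diagonal
with l points thus contributes about 16/27 l^3, which adds up to 8/27 n^4.  The
tour is closed along the left column and the bottom row.  On the first third of
its length each of these two arms also zigzags, with the last third of the
neighbouring line (whose points are removed from the snake), and the total is
then exactly [alpha].

For simplicity of the curve, any two edges are weakly separated by an affine
function with integer coefficients that does not vanish on both of them.  So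
they can only meet in a lattice point, and since edges are primitive vectors,
this point is an endpoint of both.  That the tour visits every point once
follows from its visiting every point in n^2 steps. *)

Require Import Defs.
From mathcomp Require Import all_boot all_order all_algebra reals.
From mathcomp Require Import boolp classical_sets.
From mathcomp Require Import zify ring lra.
Set Implicit Arguments.
Unset Strict Implicit.
Unset Printing Implicit Defensive.
Import Order.TTheory GRing.Theory Num.Theory.
Local Open Scope ring_scope.

(** * Separated segments *)

Definition gridpt := (nat * nat)%type.

Definition affine (A B C : int) (p : gridpt) : int :=
  A * p.1%:Z + B * p.2%:Z + C.

Definition separated (e f : gridpt * gridpt) : Prop :=
  exists A B C : int,
    [/\ affine A B C e.1 <= 0, affine A B C e.2 <= 0,
        0 <= affine A B C f.1, 0 <= affine A B C f.2 &
        ~~ [&& affine A B C e.1 == 0, affine A B C e.2 == 0,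
               affine A B C f.1 == 0 & affine A B C f.2 == 0]].

Definition primitive (e : gridpt * gridpt) : Prop :=
  exists A B : int,
    A * (e.2.1%:Z - e.1.1%:Z) + B * (e.2.2%:Z - e.1.2%:Z) = 1.

Section Geometry.
Variable R : realType.

Definition embed (p : gridpt) : R * R := (p.1.+1%:R, p.2.+1%:R).

Lemma embed_inj : injective embed.
Proof.
by move=> [x y] [x' y'] [] /eqP + /eqP; rewrite !eqr_nat => /eqP[->] /eqP[->].
Qed.

Lemma primitive_lattice e v : primitive e ->
  segment (embed e.1) (embed e.2) (embed v) -> v = e.1 \/ v = e.2.
Proof.
case: e => -[ax ay] [bx by_] [A [B]] /= hAB [t /= /andP[t0 t1]].
case: v => vx vy [hx hy].
have ht : t = (A * (vx%:Z - ax%:Z) + B * (vy%:Z - ay%:Z))%:~R.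
  have := congr1 (fun z : int => z%:~R : R) hAB.
  rewrite !(rmorphD, rmorphM, rmorphN, rmorph1) /= -!pmulrn => hR.
  have ex : vx%:R - ax%:R = t * (bx%:R - ax%:R) :> R.
    by move: hx; rewrite -!natr1 => hx; lra.
  have ey : vy%:R - ay%:R = t * (by_%:R - ay%:R) :> R.
    by move: hy; rewrite -!natr1 => hy; lra.
  by rewrite ex ey -[LHS](mulr1 t) -[X in t * X = _]hR; ring.
move: t0 t1 hx hy; rewrite ht.
set z : int := A * _ + _; rewrite ler0z lerz1 => z0 z1.
have [->|->] : z = 0 \/ z = 1 by lia.
- move=> hx hy; left; apply: embed_inj; rewrite /embed /= -hx -hy.
  by congr pair; ring.
- move=> hx hy; right; apply: embed_inj; rewrite /embed /= -hx -hy.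
  by congr pair; ring.
Qed.

Lemma separated_meet e f p : primitive e -> primitive f -> separated e f ->
  segment (embed e.1) (embed e.2) p -> segment (embed f.1) (embed f.2) p ->
  (p = embed e.1 \/ p = embed e.2) /\ (p = embed f.1 \/ p = embed f.2).
Proof.
move=> he hf [A [B [C [ga gb gc gd nz]]]] pe pf.
suff [v pv] : exists v, p = embed v.
  by move: pe pf; rewrite pv => /(primitive_lattice he) pe
    /(primitive_lattice hf) pf; split;
    [case: pe => ->; [left|right] | case: pf => ->; [left|right]].
pose g (q : R * R) : R := A%:~R * (q.1 - 1) + B%:~R * (q.2 - 1) + C%:~R.
have gE v : (affine A B C v)%:~R = g (embed v).
  rewrite /g /affine !(rmorphD, rmorphM, rmorphN) /= -!pmulrn -!natr1.
  by congr (_ * _ + _ * _ + _); ring.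
have hg a b t : g ((1 - t) * a.1 + t * b.1, (1 - t) * a.2 + t * b.2)
    = (1 - t) * g a + t * g b by rewrite /g /=; ring.
case: pe => t /= /andP[t0 t1] pe; case: pf => s /= /andP[s0 s1] pf.
have eqg : (1 - t) * g (embed e.1) + t * g (embed e.2)
         = (1 - s) * g (embed f.1) + s * g (embed f.2) by rewrite -!hg pe pf.
move: ga gb gc gd; rewrite -!(ler_int R) !gE => ga gb gc gd.
have t1' : 0 <= 1 - t by lra.
have s1' : 0 <= 1 - s by lra.
have h1 := mulr_ge0_le0 t1' ga; have h2 := mulr_ge0_le0 t0 gb.
have h3 := mulr_ge0 s1' gc; have h4 := mulr_ge0 s0 gd.
have z1 : (1 - t) * g (embed e.1) = 0 by lra.
have z2 : t * g (embed e.2) = 0 by lra.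
have z3 : (1 - s) * g (embed f.1) = 0 by lra.
have z4 : s * g (embed f.2) = 0 by lra.
have gz v : (affine A B C v == 0) = (g (embed v) == 0).
  by rewrite -gE intr_eq0.
move: nz; rewrite !gz !negb_and => /or4P[] nz.
- exists e.2; rewrite -pe.
  move: z1 => /eqP; rewrite mulf_eq0 (negbTE nz) orbF subr_eq0 => /eqP <-.
  by rewrite /embed /=; congr pair; ring.
- exists e.1; rewrite -pe.
  move: z2 => /eqP; rewrite mulf_eq0 (negbTE nz) orbF => /eqP ->.
  by rewrite /embed /=; congr pair; ring.
- exists f.2; rewrite -pf.
  move: z3 => /eqP; rewrite mulf_eq0 (negbTE nz) orbF subr_eq0 => /eqP <-.
  by rewrite /embed /=; congr pair; ring.
- exists f.1; rewrite -pf.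
  move: z4 => /eqP; rewrite mulf_eq0 (negbTE nz) orbF => /eqP ->.
  by rewrite /embed /=; congr pair; ring.
Qed.

End Geometry.

(** * Straight walks and zigzags *)

Definition swap (e : gridpt * gridpt) : gridpt * gridpt := (e.2, e.1).

Lemma separated_swapl e f : separated e f -> separated (swap e) f.
Proof.
move=> [A [B [C [h1 h2 h3 h4 h5]]]]; exists A, B, C; split => //.
by move: h5; rewrite /= andbCA.
Qed.

Lemma separated_swapr e f : separated e f -> separated e (swap f).
Proof.
move=> [A [B [C [h1 h2 h3 h4 h5]]]]; exists A, B, C; split => //.
by move: h5; rewrite /= [(_ == 0) && (affine _ _ _ f.2 == _)]andbC.
Qed.

Lemma primitive_swap e : primitive e -> primitive (swap e).
Proof. by move=> [A [B h]]; exists (- A), (- B); rewrite /= -h; ring. Qed.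

Definition walk (f : nat -> gridpt) m := [seq f i | i <- iota 1 m].

Definition steps (f : nat -> gridpt) m := [seq (f i, f i.+1) | i <- iota 0 m].

Lemma last_walk f m : last (f 0%N) (walk f m) = f m.
Proof.
case: m => [|m] //.
by rewrite /walk -[in iota _ _](addn1 m) iotaD map_cat last_cat /= add1n.
Qed.

Lemma pairmap_walk f m : pairmap pair (f 0%N) (walk f m) = steps f m.
Proof.
rewrite /walk /steps; elim: m 0%N => //= m IH i.
by rewrite IH.
Qed.

Definition noncrossing (s : seq (gridpt * gridpt)) : bool :=
  pairwise (fun e f => `[< separated e f >]) s.

Definition apart (s t : seq (gridpt * gridpt)) : bool :=
  allrel (fun e f => `[< separated e f >]) s t.

Lemma noncrossing_steps f m :
  (forall i j, (i < j < m)%N -> separated (f i, f i.+1) (f j, f j.+1)) ->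
  noncrossing (steps f m).
Proof.
move=> h; rewrite /noncrossing /steps pairwise_map.
have : pairwise ltn (iota 0 m).
  by rewrite -sorted_pairwise ?iota_ltn_sorted //; apply: ltn_trans.
apply: sub_in_pairwise; last exact: (allss (iota 0 m)).
move=> i j; rewrite /= inE !mem_iota add0n => _ /= hj ij.
by apply: h; rewrite ij.
Qed.

Lemma steps_line f m (x y dx dy A B : int) : A * dx + B * dy = 1 ->
  (forall i, (i <= m)%N -> (f i).1%:Z = x + i%:Z * dx /\
                           (f i).2%:Z = y + i%:Z * dy) ->
  noncrossing (steps f m) /\ {in steps f m, forall e, primitive e}.
Proof.
move=> AB hf; split.
  apply: noncrossing_steps => i j /andP[ij jm].
  exists A, B, (- (A * x + B * y + j%:Z)).
  have gE k : (k <= m)%N ->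
      affine A B (- (A * x + B * y + j%:Z)) (f k) = k%:Z - j%:Z.
    move=> km; rewrite /affine; have [-> ->] := hf k km.
    by transitivity (k%:Z * (A * dx + B * dy) - j%:Z); [ring | rewrite AB mulr1].
  by rewrite /= !gE; try split; lia.
move=> _ /mapP[i + ->]; rewrite mem_iota /= => im; exists A, B => /=.
have [-> ->] := hf i (ltnW im); have [-> ->] := hf i.+1 im.
by rewrite -AB intS; ring.
Qed.

Definition zigzag (u v : nat -> gridpt) i := if odd i then v i./2 else u i./2.

Lemma zigzag_even u v i : zigzag u v i.*2 = u i.
Proof. by rewrite /zigzag odd_double doubleK. Qed.

Lemma zigzag_odd u v i : zigzag u v i.*2.+1 = v i.
Proof. by rewrite /zigzag /= odd_double /= uphalf_double. Qed.

Lemma zigzag_step u v i :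
  (zigzag u v i, zigzag u v i.+1) =
  if odd i then (v i./2, u (uphalf i)) else (u (uphalf i), v i./2).
Proof.
by rewrite /zigzag /= uphalf_half; case: (odd i).
Qed.

(* The separating line is the line through the first segment. *)
Lemma separated_shift (l v l' v' : gridpt) (ux uy s t d : int) :
  l'.1%:Z = l.1%:Z + s * ux -> l'.2%:Z = l.2%:Z + s * uy ->
  v'.1%:Z = v.1%:Z + t * ux -> v'.2%:Z = v.2%:Z + t * uy ->
  (v.1%:Z - l.1%:Z) * uy - (v.2%:Z - l.2%:Z) * ux = d -> d * d = 1 ->
  0 <= s -> 0 <= t -> 0 < s + t -> separated (l, v) (l', v').
Proof.
move=> h1 h2 h3 h4 hd dd s0 t0 st.
pose A := - d * (v.2%:Z - l.2%:Z); pose B := d * (v.1%:Z - l.1%:Z).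
pose C := - (A * l.1%:Z + B * l.2%:Z).
have gl : affine A B C l = 0 by rewrite /affine /C; ring.
have gv : affine A B C v = 0 by rewrite /affine /C /A /B; ring.
have gl' : affine A B C l' = s.
  transitivity (s * (d * ((v.1%:Z - l.1%:Z) * uy - (v.2%:Z - l.2%:Z) * ux))).
    by rewrite /affine h1 h2 /C /A /B; ring.
  by rewrite hd dd mulr1.
have gv' : affine A B C v' = t.
  transitivity (t * (d * ((v.1%:Z - l.1%:Z) * uy - (v.2%:Z - l.2%:Z) * ux))).
    by rewrite /affine h3 h4 /C /A /B; ring.
  by rewrite hd dd mulr1.
by exists A, B, C; rewrite /= gl gv gl' gv'; split => //; lia.
Qed.

Lemma steps_zigzag u v m (px py qx qy ux uy d : int) :
  (qx - px) * uy - (qy - py) * ux = d -> d * d = 1 ->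
  (forall j, (j.*2 <= m)%N -> (u j).1%:Z = px + j%:Z * ux /\
                              (u j).2%:Z = py + j%:Z * uy) ->
  (forall j, (j.*2 < m)%N -> (v j).1%:Z = qx + j%:Z * ux /\
                             (v j).2%:Z = qy + j%:Z * uy) ->
  noncrossing (steps (zigzag u v) m) /\
  {in steps (zigzag u v) m, forall e, primitive e}.
Proof.
move=> hd dd hu hv; split.
  apply: noncrossing_steps => i j /andP[ij jm]; rewrite !zigzag_step.
  suff h : separated (u (uphalf i), v i./2) (u (uphalf j), v j./2).
    case: (odd i); case: (odd j) => //.
    - exact: (separated_swapl (separated_swapr h)).
    - exact: (separated_swapl h).
    - exact: (separated_swapr h).
  have [u1 u2] : _ /\ _ := hu (uphalf i) ltac:(lia).
  have [u3 u4] : _ /\ _ := hu (uphalf j) ltac:(lia).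
  have [v1 v2] : _ /\ _ := hv i./2 ltac:(lia).
  have [v3 v4] : _ /\ _ := hv j./2 ltac:(lia).
  apply: (@separated_shift _ _ _ _ ux uy
    ((uphalf j)%:Z - (uphalf i)%:Z) (j./2%:Z - i./2%:Z) d) => //.
  - by rewrite u1 u3; ring.
  - by rewrite u2 u4; ring.
  - by rewrite v1 v3; ring.
  - by rewrite v2 v4; ring.
  - by rewrite u1 u2 v1 v2 -hd; ring.
  - lia.
  - lia.
  - lia.
move=> _ /mapP[i + ->]; rewrite mem_iota /= => im; rewrite zigzag_step.
suff h : primitive (u (uphalf i), v i./2).
  by case: (odd i) => //; exact: (primitive_swap h).
have [u1 u2] : _ /\ _ := hu (uphalf i) ltac:(lia).
have [v1 v2] : _ /\ _ := hv i./2 ltac:(lia).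
exists (d * uy), (- d * ux); rewrite /= u1 u2 v1 v2.
transitivity (d * ((qx - px) * uy - (qy - py) * ux)); last by rewrite hd.
by ring.
Qed.

Definition sqlen (e : gridpt * gridpt) : int :=
  (e.2.1%:Z - e.1.1%:Z) ^+ 2 + (e.2.2%:Z - e.1.2%:Z) ^+ 2.

Lemma sum_steps_line f m (x y dx dy : int) :
  (forall i, (i <= m)%N -> (f i).1%:Z = x + i%:Z * dx /\
                           (f i).2%:Z = y + i%:Z * dy) ->
  \sum_(e <- steps f m) sqlen e = m%:Z * (dx ^+ 2 + dy ^+ 2).
Proof.
move=> hf; rewrite big_map.
rewrite (eq_big_seq (fun=> dx ^+ 2 + dy ^+ 2)) => [|i].
  by rewrite big_const_seq count_predT size_iota iter_addr_0 -mulr_natl natz.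
rewrite mem_iota /= => im; rewrite /sqlen /=.
have [-> ->] := hf i (ltnW im); have [-> ->] := hf i.+1 im.
by rewrite intS; ring.
Qed.

Lemma sum_steps_zigzag u v m (px py qx qy ux uy : int) :
  (forall j, (j.*2 <= m)%N -> (u j).1%:Z = px + j%:Z * ux /\
                              (u j).2%:Z = py + j%:Z * uy) ->
  (forall j, (j.*2 < m)%N -> (v j).1%:Z = qx + j%:Z * ux /\
                             (v j).2%:Z = qy + j%:Z * uy) ->
  \sum_(e <- steps (zigzag u v) m) sqlen e =
  (uphalf m)%:Z * ((qx - px) ^+ 2 + (qy - py) ^+ 2) +
  (m./2)%:Z * ((qx - px - ux) ^+ 2 + (qy - py - uy) ^+ 2).
Proof.
move=> hu hv.
suff H k : (k <= m)%N -> \sum_(e <- steps (zigzag u v) k) sqlen e =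
  (uphalf k)%:Z * ((qx - px) ^+ 2 + (qy - py) ^+ 2) +
  (k./2)%:Z * ((qx - px - ux) ^+ 2 + (qy - py - uy) ^+ 2) by exact: H.
elim: k => [|k IH] km; first by rewrite big_nil /=; ring.
rewrite /steps -addn1 iotaD map_cat big_cat /= -/(steps _ _) IH 1?ltnW //.
rewrite big_seq1 add0n zigzag_step addn1.
have [u1 u2] : _ /\ _ := hu (uphalf k) ltac:(lia).
have [v1 v2] : _ /\ _ := hv k./2 ltac:(lia).
case: ifPn => ok; rewrite /sqlen /= u1 u2 v1 v2.
  have -> : uphalf k = k./2.+1 by lia.
  by rewrite intS; ring.
have -> : uphalf k = k./2 by lia.
by rewrite intS; ring.
Qed.

(** * Closed polygons through all grid points *)

Section Polygon.
Variables (R : realType) (m : nat) (o : gridpt) (Q : seq gridpt).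
Let n := m.+1.
Let E := pairmap pair o Q.
Hypothesis last_Q : last o Q = o.
Hypothesis size_Q : (size Q <= n ^ 2)%N.
Hypothesis cover_Q : forall x y, (x < n)%N -> (y < n)%N -> (x, y) \in Q.
Hypothesis noncrossing_E : noncrossing E.
Hypothesis primitive_E : {in E, forall e, primitive e}.

Let grid : seq gridpt := [seq (x, y) | x <- iota 0 n, y <- iota 0 n].

Let uniq_grid : uniq grid.
Proof.
by apply: allpairs_uniq; rewrite ?iota_uniq //; move=> [? ?] [? ?] _ _.
Qed.

Let size_grid : size grid = (n ^ 2)%N.
Proof. by rewrite size_allpairs size_iota. Qed.

Let sub_grid : {subset grid <= Q}.
Proof.
by move=> p /allpairsP[[x y] [+ + ->]]; rewrite !mem_iota; apply: cover_Q.
Qed.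

Let size_QE : size Q = (n ^ 2)%N.
Proof.
apply/eqP; rewrite eqn_leq size_Q -size_grid.
exact: uniq_leq_size.
Qed.

Let mem_Q p : p \in Q -> (p.1 < n)%N && (p.2 < n)%N.
Proof.
have [_ eqi] := uniq_min_size uniq_grid sub_grid ltac:(by rewrite size_grid).
by rewrite -eqi => /allpairsP[[x y] [+ + ->]]; rewrite !mem_iota !add0n => /= -> ->.
Qed.

Let uniq_Q : uniq Q.
Proof. by apply: leq_size_uniq uniq_grid sub_grid _; rewrite size_grid. Qed.

Let P (i : nat) := nth o (o :: Q) i.

Let P_last : nth o Q (n ^ 2).-1 = o.
Proof. by rewrite -[in (n ^ 2)%N]size_QE nth_last -[RHS]last_Q; case: (Q). Qed.

Let PE (i : nat) : (i < n ^ 2)%N ->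
  P i = nth o Q (if i == 0%N then (n ^ 2).-1 else i.-1).
Proof. by case: i => [|i] //= _; rewrite P_last. Qed.

Let P_in (i : nat) : (i < n ^ 2)%N -> P i \in Q.
Proof.
move=> hi; rewrite PE //; apply: mem_nth; rewrite size_QE.
by case: ifP => // _; lia.
Qed.

Let P_inj (i j : nat) : (i < n ^ 2)%N -> (j < n ^ 2)%N -> P i = P j -> i = j.
Proof.
move=> hi hj; rewrite !PE // => /eqP; rewrite nth_uniq ?size_QE //.
- by do 2![case: ifP => //]; lia.
- by case: ifP => // _; lia.
- by case: ifP => // _; lia.
Qed.

Let P_ordS (i : 'I_(n ^ 2)) : P (ordS i) = nth o Q i.
Proof.
rewrite /=; have := ltn_ord i; rewrite leq_eqVlt => /orP[/eqP h|h].
  by rewrite h modnn [LHS]/= -[LHS]P_last -[in LHS]h.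
by rewrite modn_small.
Qed.

Let L : ordering n := [ffun i : 'I_(n ^ 2) => (inord (P i).1, inord (P i).2)].

Let vertexE i : vertex R L i = embed R (P i).
Proof.
rewrite /vertex /lattice_point /L ffunE /= /embed.
by have /mem_Q/andP[h1 h2] := P_in (ltn_ord i); rewrite !inordK.
Qed.

Let L_bij : bijective L.
Proof.
apply: inj_card_bij; last by rewrite card_prod !card_ord.
move=> i j eqL; apply/val_inj/P_inj; rewrite ?ltn_ord //.
by apply: (@embed_inj R); rewrite -!vertexE /vertex eqL.
Qed.

Let nth_E (i : nat) : (i < n ^ 2)%N -> nth (o, o) E i = (P i, nth o Q i).
Proof. by move=> hi; rewrite (nth_pairmap o) ?size_QE. Qed.

Let edgeE i : @edge R n L i = segment (embed R (P i)) (embed R (nth o Q i)).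
Proof. by rewrite /edge !vertexE P_ordS. Qed.

Let sep (i j : 'I_(n ^ 2)) : (i < j)%N ->
  separated (P i, nth o Q i) (P j, nth o Q j).
Proof.
move=> ij; have /(pairwiseP (o, o)) h := noncrossing_E.
have := h i j; rewrite !inE size_pairmap size_QE !nth_E ?ltn_ord //.
by move=> /(_ isT isT ij).
Qed.

Let prim (i : 'I_(n ^ 2)) : primitive (P i, nth o Q i).
Proof.
apply: primitive_E; rewrite -nth_E //; apply: mem_nth.
by rewrite size_pairmap size_QE.
Qed.

Let simple : non_self_intersecting R L.
Proof.
have key (i j : 'I_(n ^ 2)) (p : R * R) : (i < j)%N -> @edge R n L i p ->
    @edge R n L j p -> (j = ordS i /\ p = vertex R L j) \/
                    (i = ordS j /\ p = vertex R L i).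
  move=> ij; rewrite !edgeE => pi pj.
  have [/= hi hj] := separated_meet (prim i) (prim j) (sep ij) pi pj.
  have inj (a b : 'I_(n ^ 2)) : p = embed R (P a) -> p = embed R (P b) -> a = b.
    by move=> -> /embed_inj /P_inj h; apply/val_inj/h.
  move: hi hj; rewrite -!P_ordS => -[hi|hi] [hj|hj].
  - by have eij := inj _ _ hi hj; rewrite eij ltnn in ij.
  - by right; split; [exact: inj hi hj | rewrite vertexE].
  - by left; split; [exact: inj hj hi | rewrite vertexE].
  - have /(can_inj (@ordSK _)) eij := inj _ _ hi hj.
    by rewrite eij ltnn in ij.
move=> i j p ij pi pj; case: (ltngtP i j) => h; first exact: key.
  by have := key j i p h pj pi; tauto.
by case: ij; apply: val_inj.
Qed.

Lemma polygon_closed_broken_line :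
  exists2 L : ordering n, closed_broken_line R L &
    sum_sq_lengths R L = (\sum_(e <- E) sqlen e)%:~R.
Proof.
exists L => //; rewrite /sum_sq_lengths rmorph_sum /=.
rewrite (big_nth (o, o)) size_pairmap size_QE big_mkord; apply: eq_bigr => i _.
rewrite nth_E // !vertexE P_ordS /euclidean_norm sqr_sqrtr; last first.
  by rewrite addr_ge0 ?sqr_ge0.
rewrite /sqlen /= !(rmorphD, rmorphXn, rmorphN) /= -!pmulrn -!natr1.
by congr (_ ^+ 2 + _ ^+ 2); ring.
Qed.

Lemma le_max_sum_sq_lengths (x : R) :
  x <= (\sum_(e <- E) sqlen e)%:~R -> x <= max_sum_sq_lengths R n.
Proof.
have [L' hL' <-] := polygon_closed_broken_line; move/le_trans; apply.
by apply: (@le_bigmax_cond _ _ _ _ L' (fun L => `[< closed_broken_line R L >])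
  (fun L => sum_sq_lengths R L)); apply/asboolP.
Qed.

End Polygon.

(** * The snake along the diagonals *)

Lemma separated_x (c : int) (e f : gridpt * gridpt) :
  e.1.1%:Z <= c -> e.2.1%:Z <= c ->
  c <= f.1.1%:Z -> c <= f.2.1%:Z ->
  [|| e.1.1%:Z < c, e.2.1%:Z < c, c < f.1.1%:Z | c < f.2.1%:Z] -> separated e f.
Proof.
by move=> h1 h2 h3 h4 h5; exists 1, 0, (- c);
  rewrite /affine !(mul1r, mul0r, mulN1r, addr0, add0r); split; lia.
Qed.

Lemma separated_y (c : int) (e f : gridpt * gridpt) :
  e.1.2%:Z <= c -> e.2.2%:Z <= c ->
  c <= f.1.2%:Z -> c <= f.2.2%:Z ->
  [|| e.1.2%:Z < c, e.2.2%:Z < c, c < f.1.2%:Z | c < f.2.2%:Z] -> separated e f.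
Proof.
by move=> h1 h2 h3 h4 h5; exists 0, 1, (- c);
  rewrite /affine !(mul1r, mul0r, mulN1r, addr0, add0r); split; lia.
Qed.

Definition level (p : gridpt) : int := p.1%:Z - p.2%:Z.

Lemma separated_level (c : int) (e f : gridpt * gridpt) :
  level e.1 <= c -> level e.2 <= c ->
  c <= level f.1 -> c <= level f.2 ->
  [|| level e.1 < c, level e.2 < c, c < level f.1 | c < level f.2] ->
  separated e f.
Proof.
rewrite /level => h1 h2 h3 h4 h5; exists 1, (-1), (- c).
by rewrite /affine !(mul1r, mul0r, mulN1r, addr0, add0r); split; lia.
Qed.

Lemma separatedC e f : separated e f -> separated f e.
Proof.
move=> [A [B [C [h1 h2 h3 h4 h5]]]]; exists (- A), (- B), (- C).
have gN p : affine (- A) (- B) (- C) p = - affine A B C p.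
  by rewrite /affine; ring.
by rewrite !gN; split; lia.
Qed.

Lemma mem_walk f m i : (0 < i <= m)%N -> f i \in walk f m.
Proof. by move=> h; apply: map_f; rewrite mem_iota; lia. Qed.

Lemma size_walk f m : size (walk f m) = m.
Proof. by rewrite size_map size_iota. Qed.

Lemma noncrossing_cat s t :
  noncrossing (s ++ t) = [&& apart s t, noncrossing s & noncrossing t].
Proof. exact: pairwise_cat. Qed.

Lemma apartP s t :
  (forall e f, e \in s -> f \in t -> separated e f) -> apart s t.
Proof. by move=> h; apply/allrelP => e f es ft; apply/asboolP/h. Qed.

Section Snake.
Variables N k1 k2 : nat.
Hypotheses (k1_gt0 : (0 < k1)%N) (k2_gt0 : (0 < k2)%N).
Hypotheses (k1N : (k1 + 3 <= N)%N) (k2N : (k2 + 3 <= N)%N).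

(* Diagonal number d consists of the points (x, x + N - d) with x in
   [lo d, hi d].  The extra unit in [lo] skips its first point when that point
   belongs to the zigzag of the left column (first case) or of the bottom row
   (second case). *)
Definition lo d : nat :=
  (if d <= N then if 2 <= d <= k1.+1 then 2 else 1
   else if 2 * N <= d + k2.+1 < 2 * N + k2 then d.+2 - N else d.+1 - N)%N.

Definition hi d : nat := minn d N.

Definition width d : nat := (hi d.+1 + 1 - lo d)%N.

Definition third w : nat := ((w + 2) %/ 3)%N.

(* The snake leaves diagonal d at abscissa [turn d] and, after the zigzag,
   resumes on diagonal d.+1 at abscissa [top d]. *)
Definition turn d : nat := (lo d + third (width d) - 1)%N.

Definition top d : nat := (hi d.+1 + 1 - third (width d))%N.

Definition diag d x : gridpt := (x, x + N - d)%N.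

Definition zig d := zigzag (fun j => diag d (turn d - j)%N)
                           (fun j => diag d.+1 (hi d.+1 - j)%N).

Definition run d i := diag d.+1 (top d - i)%N.

Definition zig_len d := (third (width d)).*2.-1.

Definition run_len d := (top d - turn d.+1)%N.

Definition block d := walk (zig d) (zig_len d) ++ walk (run d) (run_len d).

Definition block_steps d :=
  steps (zig d) (zig_len d) ++ steps (run d) (run_len d).

Definition snake d m := flatten [seq block e | e <- iota d m].

Definition snake_steps d m := flatten [seq block_steps e | e <- iota d m].

Ltac snk := rewrite /run_len /zig_len /top /turn /third /width /hi /lo;
  repeat (case: ifP => ?); lia.

Lemma lo_gt0 d : (0 < lo d)%N. Proof. snk. Qed.

Lemma lo_diag d : (0 < d)%N -> (d < lo d + N)%N. Proof. move=> ?; snk. Qed.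

Lemma third_gt0 d : (0 < d < 2 * N)%N -> (0 < third (width d))%N.
Proof. move=> ?; snk. Qed.

Lemma third_le_hi d : (0 < d < 2 * N - 1)%N ->
  (lo d.+1 + third (width d) <= hi d.+1 + 1)%N.
Proof. move=> ?; snk. Qed.

Lemma turn_le_top d : (0 < d < 2 * N - 1)%N -> (turn d.+1 <= top d)%N.
Proof. move=> ?; snk. Qed.

Lemma zig0 d : zig d 0 = diag d (turn d).
Proof. by rewrite /zig /zigzag /= subn0. Qed.

Lemma run0 d : run d 0 = diag d.+1 (top d).
Proof. by rewrite /run subn0. Qed.

Lemma zig_last d : (0 < d < 2 * N - 1)%N -> zig d (zig_len d) = run d 0.
Proof.
move=> hd; have k0 := third_gt0 (ltac:(lia) : (0 < d < 2 * N)%N); have := third_le_hi hd.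
have -> : zig_len d = (third (width d)).-1.*2.+1 by rewrite /zig_len; lia.
by rewrite /zig zigzag_odd run0 /top => h; congr diag; lia.
Qed.

Lemma run_last d : (0 < d < 2 * N - 1)%N -> run d (run_len d) = zig d.+1 0.
Proof.
by move=> hd; have h := turn_le_top hd; rewrite zig0 /run /run_len subKn.
Qed.

Lemma last_block d : (0 < d < 2 * N - 1)%N ->
  last (zig d 0) (block d) = zig d.+1 0.
Proof.
by move=> hd; rewrite last_cat last_walk zig_last // last_walk run_last.
Qed.

Lemma pairmap_block d : (0 < d < 2 * N - 1)%N ->
  pairmap pair (zig d 0) (block d) = block_steps d.
Proof.
by move=> hd; rewrite pairmap_cat last_walk pairmap_walk zig_last // pairmap_walk.
Qed.

Lemma last_snake m d : (0 < d)%N -> (d + m <= 2 * N - 1)%N ->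
  last (zig d 0) (snake d m) = zig (d + m) 0.
Proof.
elim: m d => [|m IH] d d0 hm; first by rewrite addn0.
by rewrite /snake /= last_cat last_block ?IH ?addSnnS //; lia.
Qed.

Lemma pairmap_snake m d : (0 < d)%N -> (d + m <= 2 * N - 1)%N ->
  pairmap pair (zig d 0) (snake d m) = snake_steps d m.
Proof.
elim: m d => [|m IH] d d0 hm //.
by rewrite /snake /= pairmap_cat last_block ?pairmap_block ?IH //; lia.
Qed.

Lemma steps_zig d : (0 < d < 2 * N - 1)%N ->
  noncrossing (steps (zig d) (zig_len d)) /\
  {in steps (zig d) (zig_len d), forall e, primitive e}.
Proof.
move=> hd; have k0 := third_gt0 (ltac:(lia) : (0 < d < 2 * N)%N); have hk := third_le_hi hd.
have l0 := lo_gt0 d.+1; have l1 := lo_gt0 d.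
have ld := lo_diag (ltac:(lia) : (0 < d)%N).
have ld1 := lo_diag (ltn0Sn d).
apply: (@steps_zigzag _ _ _ (turn d)%:Z ((turn d)%:Z + N%:Z - d%:Z)
  (hi d.+1)%:Z ((hi d.+1)%:Z + N%:Z - d.+1%:Z) (-1) (-1) (-1)) => //.
- by rewrite intS; ring.
- move=> j; rewrite /zig_len /turn /= => hj; split; lia.
- move=> j; rewrite /zig_len /= => hj; split; lia.
Qed.

Lemma steps_run d : (0 < d < 2 * N - 1)%N ->
  noncrossing (steps (run d) (run_len d)) /\
  {in steps (run d) (run_len d), forall e, primitive e}.
Proof.
move=> hd; have hk := turn_le_top hd.
have k0 := third_gt0 (ltac:(lia) : (0 < d.+1 < 2 * N)%N).
have l0 := lo_gt0 d.+1; have ld1 := lo_diag (ltn0Sn d).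
apply: (@steps_line _ _ (top d)%:Z ((top d)%:Z + N%:Z - d.+1%:Z) (-1) (-1) (-1) 0) => //.
move=> i; rewrite /run_len /run /= => hi; move: hk hi; rewrite /turn; split; lia.
Qed.

Lemma steps_zig_bounds d (e : gridpt * gridpt) : (0 < d < 2 * N - 1)%N ->
  e \in steps (zig d) (zig_len d) ->
  [/\ (0 < e.1.1)%N && (0 < e.1.2)%N, (0 < e.2.1)%N && (0 < e.2.2)%N &
      (level e.1 = d%:Z - N%:Z /\ level e.2 = d.+1%:Z - N%:Z) \/
      (level e.2 = d%:Z - N%:Z /\ level e.1 = d.+1%:Z - N%:Z)].
Proof.
move=> hd; have k0 := third_gt0 (ltac:(lia) : (0 < d < 2 * N)%N); have hk := third_le_hi hd.
have l0 := lo_gt0 d.+1; have l1 := lo_gt0 d.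
have ld := lo_diag (ltac:(lia) : (0 < d)%N).
have ld1 := lo_diag (ltn0Sn d).
move=> /mapP[i + ->]; rewrite mem_iota add0n => hi.
rewrite /zig zigzag_step /level; move: hi; rewrite /zig_len /turn => hi.
by case: (odd i) => /=; split; lia.
Qed.

Lemma steps_run_bounds d (e : gridpt * gridpt) : (0 < d < 2 * N - 1)%N ->
  e \in steps (run d) (run_len d) ->
  [/\ (0 < e.1.1)%N && (0 < e.1.2)%N, (0 < e.2.1)%N && (0 < e.2.2)%N &
      level e.1 = d.+1%:Z - N%:Z /\ level e.2 = d.+1%:Z - N%:Z].
Proof.
move=> hd; have hk := turn_le_top hd.
have k0 := third_gt0 (ltac:(lia) : (0 < d.+1 < 2 * N)%N).
have l0 := lo_gt0 d.+1; have ld1 := lo_diag (ltn0Sn d).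
move=> /mapP[i + ->]; rewrite mem_iota add0n /level /run /= => hi.
by move: hk hi; rewrite /run_len /turn => hk hi; split; lia.
Qed.

Lemma apart_zig_run d : (0 < d < 2 * N - 1)%N ->
  apart (steps (zig d) (zig_len d)) (steps (run d) (run_len d)).
Proof.
move=> hd; apply: apartP => e f he hf.
have [_ _ h1] := steps_zig_bounds hd he; have [_ _ h2] := steps_run_bounds hd hf.
by apply: (@separated_level (d.+1%:Z - N%:Z)); lia.
Qed.

Lemma block_steps_noncrossing d : (0 < d < 2 * N - 1)%N ->
  noncrossing (block_steps d).
Proof.
move=> hd; rewrite noncrossing_cat apart_zig_run //.
by rewrite (proj1 (steps_zig hd)) (proj1 (steps_run hd)).
Qed.

Lemma apart_blocks d d' : (0 < d < d')%N -> (d' < 2 * N - 1)%N ->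
  apart (block_steps d) (block_steps d').
Proof.
move=> h1 h2; apply: apartP => e f he hf.
have hd : (0 < d < 2 * N - 1)%N by lia.
have hd' : (0 < d' < 2 * N - 1)%N by lia.
apply: (@separated_level (d.+1%:Z - N%:Z)).
all: move: he hf; rewrite !mem_cat => /orP[/(steps_zig_bounds hd)|
  /(steps_run_bounds hd)] [_ _ le] /orP[/(steps_zig_bounds hd')|
  /(steps_run_bounds hd')] [_ _ lf]; lia.
Qed.

Lemma snake_steps_noncrossing m d : (0 < d)%N -> (d + m <= 2 * N - 1)%N ->
  noncrossing (snake_steps d m).
Proof.
elim: m d => [|m IH] d d0 hm //.
rewrite /snake_steps /= noncrossing_cat block_steps_noncrossing ?IH; try lia.
rewrite !andbT; apply: apartP => e f he /flattenP[s /mapP[d' + ->]] hf.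
rewrite mem_iota => hd'.
have /allrelP/(_ e f he hf)/asboolP // := @apart_blocks d d' ltac:(lia) ltac:(lia).
Qed.

Lemma snake_steps_primitive m d : (0 < d)%N -> (d + m <= 2 * N - 1)%N ->
  {in snake_steps d m, forall e, primitive e}.
Proof.
move=> d0 hm e /flattenP[s /mapP[d' + ->]]; rewrite mem_iota => hd'.
have hd : (0 < d' < 2 * N - 1)%N by lia.
rewrite mem_cat => /orP[].
  exact: (proj2 (steps_zig hd)).
exact: (proj2 (steps_run hd)).
Qed.

Lemma snake_steps_bounds m d (e : gridpt * gridpt) : (0 < d)%N -> (d + m <= 2 * N - 1)%N ->
  e \in snake_steps d m ->
  (0 < e.1.1)%N && (0 < e.1.2)%N && ((0 < e.2.1)%N && (0 < e.2.2)%N).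
Proof.
move=> d0 hm /flattenP[s /mapP[d' + ->]]; rewrite mem_iota => hd'.
have hd : (0 < d' < 2 * N - 1)%N by lia.
rewrite mem_cat => /orP[/(steps_zig_bounds hd)|/(steps_run_bounds hd)] [-> -> _].
  by [].
by [].
Qed.

Lemma snake_cover x y : (0 < x <= N)%N -> (0 < y <= N)%N ->
  (lo (x + N - y) <= x)%N ->
  (x, y) \in zig 1 0 :: snake 1 (2 * N - 2).
Proof.
move=> hx hy; set d := (x + N - y)%N => hlo.
have xy : (x, y) = diag d x by rewrite /diag /d; congr pair; lia.
have in_block e p : (0 < e < 2 * N - 1)%N -> p \in block e ->
    p \in zig 1 0 :: snake 1 (2 * N - 2).
  move=> he pe; rewrite inE; apply/orP; right; apply/flattenP.
  by exists (block e) => //; apply: map_f; rewrite mem_iota; lia.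
have d0 : (0 < d)%N by lia.
case: (ltnP x (turn d)) => [xt|xt].
  have hd : (0 < d < 2 * N - 1)%N.
    suff : d <> (2 * N - 1)%N by lia.
    by move=> dN; move: xt; rewrite dN; snk.
  apply: (in_block d) => //; rewrite mem_cat; apply/orP; left.
  have -> : (x, y) = zig d (turn d - x).*2.
    by rewrite /zig zigzag_even xy; congr diag; lia.
  by apply: mem_walk; move: xt hlo; rewrite /zig_len /turn; lia.
case: (leqP d 1) => [d1|d1].
  have -> : (x, y) = zig 1 0.
    have -> : 1%N = d by lia.
    rewrite zig0 xy; congr diag; move: xt; have -> : d = 1%N by lia.
    have : (x <= d)%N by lia.
    move=> xd _; have -> : x = 1%N by lia.
    by clear; snk.
  by rewrite mem_head.
have hd : (0 < d.-1 < 2 * N - 1)%N by lia.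
have dS : d = d.-1.+1 by lia.
apply: (in_block d.-1) => //; rewrite mem_cat; apply/orP.
case: (ltnP x (top d.-1)) => [xt'|xt'].
  right; have -> : (x, y) = run d.-1 (top d.-1 - x).
    by rewrite /run -dS xy; congr diag; lia.
  by apply: mem_walk; rewrite /run_len -dS; lia.
left; have xhi : (x <= hi d)%N by rewrite /hi; lia.
have -> : (x, y) = zig d.-1 (hi d - x).*2.+1.
  by rewrite /zig zigzag_odd -dS xy; congr diag; lia.
apply: mem_walk; move: xt'; rewrite /zig_len /top -dS.
have := third_gt0 (ltac:(lia) : (0 < d.-1 < 2 * N)%N); lia.
Qed.

Definition zig_sum w : int :=
  let k := (third w)%:Z in let D := w%:Z - k in
  k * (D ^+ 2 + (D - 1) ^+ 2) + (k - 1) * ((D + 1) ^+ 2 + D ^+ 2).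

Definition gain w : int := zig_sum w + 2 * w%:Z + 2 - 4 * (third w)%:Z.

Lemma size_block d : (0 < d < 2 * N - 1)%N ->
  (size (block d))%:Z = (width d)%:Z +
    ((lo d)%:Z + (third (width d))%:Z) -
    ((lo d.+1)%:Z + (third (width d.+1))%:Z).
Proof.
move=> hd; have k0 := third_gt0 (ltac:(lia) : (0 < d < 2 * N)%N).
have k1' := third_gt0 (ltac:(lia) : (0 < d.+1 < 2 * N)%N).
have hk := third_le_hi hd; have ht := turn_le_top hd.
have l0 := lo_gt0 d; have l1 := lo_gt0 d.+1.
have ww : (hi d.+1 + 1 = width d + lo d)%N by snk.
rewrite size_cat !size_walk /run_len /zig_len; move: ht; rewrite /top /turn; lia.
Qed.

Lemma sum_block_steps d : (0 < d < 2 * N - 1)%N ->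
  \sum_(e <- block_steps d) sqlen e = gain (width d) +
    2 * ((lo d)%:Z + (third (width d))%:Z) -
    2 * ((lo d.+1)%:Z + (third (width d.+1))%:Z).
Proof.
move=> hd; have k0 := third_gt0 (ltac:(lia) : (0 < d < 2 * N)%N).
have k1' := third_gt0 (ltac:(lia) : (0 < d.+1 < 2 * N)%N).
have hk := third_le_hi hd; have ht := turn_le_top hd.
have l0 := lo_gt0 d.+1; have l1 := lo_gt0 d.
have ld := lo_diag (ltac:(lia) : (0 < d)%N).
have ld1 := lo_diag (ltn0Sn d).
have ww : (hi d.+1 + 1 = width d + lo d)%N by snk.
rewrite big_cat /=.
rewrite (@sum_steps_zigzag _ _ _ (turn d)%:Z ((turn d)%:Z + N%:Z - d%:Z)
  (hi d.+1)%:Z ((hi d.+1)%:Z + N%:Z - d.+1%:Z) (-1) (-1)); last 2 first.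
- by move=> j; rewrite /zig_len /turn /= => hj; split; lia.
- by move=> j; rewrite /zig_len /= => hj; split; lia.
rewrite (@sum_steps_line _ _ (top d)%:Z ((top d)%:Z + N%:Z - d.+1%:Z) (-1) (-1));
  last first.
  by move=> i; rewrite /run_len /run /= => hi; move: ht hi; rewrite /turn; split; lia.
have -> : uphalf (zig_len d) = third (width d) by rewrite /zig_len; lia.
have -> : ((zig_len d)./2)%:Z = (third (width d))%:Z - 1 by rewrite /zig_len; lia.
have -> : (turn d)%:Z = (lo d)%:Z + (third (width d))%:Z - 1 by rewrite /turn; lia.
have -> : (hi d.+1)%:Z = (width d)%:Z + (lo d)%:Z - 1 by lia.
have -> : (run_len d)%:Z = (width d)%:Z + (lo d)%:Z - (third (width d))%:Z -
    ((lo d.+1)%:Z + (third (width d.+1))%:Z - 1).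
  by move: ht; rewrite /run_len /top /turn; lia.
by rewrite /gain /zig_sum intS; ring.
Qed.

Lemma lo1 : lo 1 = 1%N. Proof. by snk. Qed.

Lemma width1 : width 1 = 2%N. Proof. by snk. Qed.

Lemma lo_last : lo (2 * N - 1) = N. Proof. by snk. Qed.

Lemma width_last : width (2 * N - 1) = 1%N. Proof. by snk. Qed.

Lemma zig_first : zig 1 0 = (1, N)%N.
Proof. by rewrite zig0 /diag /turn /third lo1 width1 /=; congr pair; lia. Qed.

Lemma zig_end : zig (2 * N - 1) 0 = (N, 1)%N.
Proof. by rewrite zig0 /diag /turn /third lo_last width_last /=; congr pair; lia. Qed.

Lemma telescope_blocks (F : nat -> int) (c : int) (g : nat -> int) :
  (forall d, (0 < d < 2 * N - 1)%N ->
    g d = F (width d) + c * ((lo d)%:Z + (third (width d))%:Z) -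
          c * ((lo d.+1)%:Z + (third (width d.+1))%:Z)) ->
  \sum_(1 <= d < 2 * N - 1) g d =
  \sum_(1 <= d < 2 * N - 1) F (width d) + c * (1 - N%:Z).
Proof.
move=> hg; pose h d := - (c * ((lo d)%:Z + (third (width d))%:Z)).
rewrite (eq_big_nat _ _ (F2 := fun d => F (width d) + (h d.+1 - h d))); last first.
  by move=> d hd; rewrite hg // /h; ring.
rewrite big_split /= telescope_sumr; last by lia.
by rewrite /h lo1 width1 lo_last width_last /=; congr (_ + _); ring.
Qed.

Lemma sum_width (F : nat -> int) :
  \sum_(1 <= d < 2 * N - 1) F (width d) =
  2 * (\sum_(0 <= w < N) F w.+1) + F 2%N - F 1%N - F k1.+2 - F k2.+1.
Proof.
pose G m := \sum_(0 <= w < m) F w.+1.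
have GS m : G m.+1 = G m + F m.+1 by rewrite /G big_nat_recr.
have phase a b (h : nat -> int) : (a <= b)%N ->
    (forall d, (a <= d < b)%N -> F (width d) = h d.+1 - h d) ->
    \sum_(a <= d < b) F (width d) = h b - h a.
  by move=> ab hF; rewrite (eq_big_nat _ _ hF) telescope_sumr.
rewrite (big_cat_nat (n := (2 * N - k2.+1)%N)) /=; try lia.
rewrite (big_cat_nat (n := N)) /=; try lia.
rewrite (big_cat_nat (n := k1.+2)) /=; try lia.
rewrite (big_cat_nat (n := 2%N)) //=.
rewrite big_nat1 width1.
rewrite (phase 2%N k1.+2 (fun d => G d.-1)) //; last first.
  move=> [|d] hd; first by lia.
  rewrite /= GS; have -> : width d.+1 = d.+1 by snk.
  by ring.
rewrite (phase k1.+2 N G); last 2 first.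
- by lia.
- move=> d hd; rewrite GS; have -> : width d = d.+1 by snk.
  by ring.
rewrite (phase N (2 * N - k2.+1)%N (fun d => - G (2 * N - d)%N)); last 2 first.
- by lia.
- move=> d hd; have -> : (2 * N - d = (2 * N - d.+1).+1)%N by lia.
  rewrite GS; have -> : width d = (2 * N - d.+1).+1 by snk.
  by ring.
rewrite (phase (2 * N - k2.+1)%N (2 * N - 1)%N (fun d => - G (2 * N - 1 - d)%N));
  last 2 first.
- by lia.
- move=> d hd; have -> : (2 * N - 1 - d = (2 * N - 1 - d.+1).+1)%N by lia.
  rewrite GS; have -> : width d = (2 * N - 1 - d.+1).+1 by snk.
  by ring.
have -> : (2 * N - N = N)%N by lia.
have -> : (2 * N - (2 * N - k2.+1) = k2.+1)%N by lia.
have -> : (2 * N - 1 - (2 * N - 1) = 0)%N by lia.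
have -> : (2 * N - 1 - (2 * N - k2.+1) = k2)%N by lia.
rewrite /= !GS.
have -> : G 0%N = 0 by rewrite /G big_nil.
by rewrite -/(G N); ring.
Qed.

Lemma size_snake :
  (size (snake 1 (2 * N - 2)))%:Z = N%:Z ^+ 2 - k1%:Z - k2%:Z - 1.
Proof.
have -> : (size (snake 1 (2 * N - 2)))%:Z =
    \sum_(1 <= d < 2 * N - 1) (size (block d))%:Z.
  rewrite /index_iota (_ : 2 * N - 1 - 1 = 2 * N - 2)%N; last by lia.
  rewrite /snake; elim: (iota _ _) => [|d s IH]; first by rewrite big_nil.
  by rewrite big_cons /= size_cat PoszD IH.
rewrite (@telescope_blocks Posz 1); last first.
  by move=> d hd; rewrite size_block // !mul1r.
rewrite sum_width.
have -> : \sum_(0 <= w < N) w.+1%:Z = (\sum_(0 <= w < N.+1) w)%N%:Z.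
  elim: N => [|p IH]; first by rewrite !big_nat1 big_nil.
  by rewrite big_nat_recr //= IH [in RHS]big_nat_recr //= PoszD.
rewrite bin2_sum; have /= h := mul_bin_diag N.+1 1; rewrite bin1 in h.
have -> : 2 * 'C(N.+1, 2)%:Z = N.+1%:Z * N%:Z by rewrite -!PoszM h.
by rewrite !intS; ring.
Qed.

Lemma sum_snake_steps :
  \sum_(e <- snake_steps 1 (2 * N - 2)) sqlen e =
  2 * (\sum_(0 <= w < N) gain w.+1) + gain 2%N - gain 1%N - gain k1.+2 -
  gain k2.+1 + 2 * (1 - N%:Z).
Proof.
have -> : \sum_(e <- snake_steps 1 (2 * N - 2)) sqlen e =
    \sum_(1 <= d < 2 * N - 1) \sum_(e <- block_steps d) sqlen e.
  rewrite /index_iota (_ : 2 * N - 1 - 1 = 2 * N - 2)%N; last by lia.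
  rewrite /snake_steps; elim: (iota _ _) => [|d s IH]; first by rewrite !big_nil.
  by rewrite big_cons /= big_cat IH.
rewrite (@telescope_blocks gain 2); last exact: sum_block_steps.
by rewrite sum_width.
Qed.

End Snake.

(** * The tour *)

Lemma noncrossing1 e : noncrossing [:: e]. Proof. by []. Qed.

Lemma apart_catr s t u : apart s (t ++ u) = apart s t && apart s u.
Proof. exact: allrel_catr. Qed.

Section Tour.
Variables N k1 k2 : nat.
Hypotheses (k1_gt0 : (0 < k1)%N) (k2_gt0 : (0 < k2)%N).
Hypotheses (k1N : (k1 + 3 <= N)%N) (k2N : (k2 + 3 <= N)%N).

Definition leftzig := zigzag (fun j => (0, j)%N) (fun j => (1, N - k1 + j)%N).
Definition leftrun i : gridpt := (0, k1 + i)%N.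
Definition botrun i : gridpt := (N - i, 0)%N.
Definition botzig :=
  zigzag (fun j => (k2 - j, 0)%N) (fun j => (N - 1 - j, 1)%N).

Definition tour : seq gridpt :=
  walk leftzig k1.*2 ++ walk leftrun (N - k1) ++ (1, N)%N ::
  snake N k1 k2 1 (2 * N - 2) ++ (N, 0)%N ::
  walk botrun (N - k2) ++ walk botzig k2.*2.

Definition left_steps : seq (gridpt * gridpt) :=
  steps leftzig k1.*2 ++ steps leftrun (N - k1) ++ [:: ((0, N), (1, N))%N].

Definition bot_steps : seq (gridpt * gridpt) :=
  [:: ((N, 1), (N, 0))%N] ++ steps botrun (N - k2) ++ steps botzig k2.*2.

Let leftzig0 : (0, 0)%N = leftzig 0. Proof. by []. Qed.

Let leftzig_last : leftzig k1.*2 = leftrun 0.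
Proof. by rewrite /leftzig zigzag_even /leftrun addn0. Qed.

Let leftrun_last : leftrun (N - k1) = (0, N)%N.
Proof. by rewrite /leftrun; congr pair; lia. Qed.

Let botrun0 : (N, 0)%N = botrun 0.
Proof. by rewrite /botrun subn0. Qed.

Let botrun_last : botrun (N - k2) = botzig 0.
Proof. by rewrite /botrun /botzig /zigzag /=; congr pair; lia. Qed.

Lemma pairmap_tour : pairmap pair (0, 0)%N tour =
  left_steps ++ snake_steps N k1 k2 1 (2 * N - 2) ++ bot_steps.
Proof.
rewrite leftzig0 /tour pairmap_cat pairmap_walk last_walk leftzig_last.
rewrite pairmap_cat pairmap_walk last_walk leftrun_last /=.
rewrite -(@zig_first N k1 k2) // pairmap_cat pairmap_snake //; last by lia.
rewrite last_snake //; last by lia.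
rewrite /= (_ : 1 + (2 * N - 2) = 2 * N - 1)%N; last by lia.
rewrite zig_end // botrun0 pairmap_cat pairmap_walk last_walk botrun_last.
by rewrite pairmap_walk zig_first // -botrun0 /left_steps /bot_steps -!catA.
Qed.

Lemma last_tour : last (0, 0)%N tour = (0, 0)%N.
Proof.
rewrite /tour !last_cat /= !last_cat /= botrun0.
rewrite !last_cat last_walk botrun_last last_walk.
by rewrite /botzig zigzag_even subnn.
Qed.

Let left_zig : noncrossing (steps leftzig k1.*2) /\
  {in steps leftzig k1.*2, forall e, primitive e}.
Proof.
apply: (@steps_zigzag _ _ _ 0 0 1 (N%:Z - k1%:Z) 0 1 1) => //.
- by ring.
- by move=> j hj /=; split; lia.
- by move=> j hj /=; split; lia.
Qed.

Let left_run : noncrossing (steps leftrun (N - k1)) /\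
  {in steps leftrun (N - k1), forall e, primitive e}.
Proof.
apply: (@steps_line _ _ 0 k1%:Z 0 1 0 1) => //.
by move=> j hj /=; split; lia.
Qed.

Let bot_run : noncrossing (steps botrun (N - k2)) /\
  {in steps botrun (N - k2), forall e, primitive e}.
Proof.
apply: (@steps_line _ _ N%:Z 0 (-1) 0 (-1) 0) => //.
by move=> j hj /=; split; lia.
Qed.

Let bot_zig : noncrossing (steps botzig k2.*2) /\
  {in steps botzig k2.*2, forall e, primitive e}.
Proof.
apply: (@steps_zigzag _ _ _ k2%:Z 0 (N%:Z - 1) 1 (-1) 0 1) => //.
- by ring.
- by move=> j hj /=; split; lia.
- by move=> j hj /=; split; lia.
Qed.

Let left_zig_bounds (e : gridpt * gridpt) : e \in steps leftzig k1.*2 ->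
  [/\ (e.1.1 + e.2.1 = 1)%N, (e.1.2 < N)%N && (e.2.2 < N)%N,
      level e.1 <= 0, level e.2 <= 0 & level e.1 + level e.2 < 0].
Proof.
move=> /mapP[i + ->]; rewrite mem_iota add0n => hi.
by rewrite /leftzig zigzag_step /level; case: (odd i) => /=; split; lia.
Qed.

Let left_run_bounds (e : gridpt * gridpt) : e \in steps leftrun (N - k1) ->
  [/\ e.1.1 = 0%N, e.2.1 = 0%N & level e.1 < 0 /\ level e.2 < 0].
Proof.
move=> /mapP[i + ->]; rewrite mem_iota add0n => hi.
by rewrite /leftrun /level /=; split; lia.
Qed.

Let bot_run_bounds (e : gridpt * gridpt) : e \in steps botrun (N - k2) ->
  [/\ e.1.2 = 0%N, e.2.2 = 0%N & 0 < level e.1 /\ 0 < level e.2].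
Proof.
move=> /mapP[i + ->]; rewrite mem_iota add0n => hi.
by rewrite /botrun /level /=; split; lia.
Qed.

Let bot_zig_bounds (e : gridpt * gridpt) : e \in steps botzig k2.*2 ->
  [/\ (e.1.2 + e.2.2 = 1)%N, (e.1.1 < N)%N && (e.2.1 < N)%N,
      0 <= level e.1, 0 <= level e.2 & 0 < level e.1 + level e.2].
Proof.
move=> /mapP[i + ->]; rewrite mem_iota add0n => hi.
by rewrite /botzig zigzag_step /level; case: (odd i) => /=; split; lia.
Qed.

Let left_bounds (e : gridpt * gridpt) : e \in left_steps ->
  [/\ (e.1.1 + e.2.1 <= 1)%N, level e.1 <= 0, level e.2 <= 0 &
      level e.1 + level e.2 < 0].
Proof.
rewrite !mem_cat => /or3P[/left_zig_bounds[]|/left_run_bounds[]|].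
- by split; lia.
- by split; lia.
by rewrite mem_seq1 => /eqP ->; rewrite /level /=; split; lia.
Qed.

Let bot_bounds (e : gridpt * gridpt) : e \in bot_steps ->
  [/\ (e.1.2 + e.2.2 <= 1)%N, 0 <= level e.1, 0 <= level e.2 &
      0 < level e.1 + level e.2].
Proof.
rewrite !mem_cat => /or3P[|/bot_run_bounds[]|/bot_zig_bounds[]].
- by rewrite mem_seq1 => /eqP ->; rewrite /level /=; split; lia.
- by split; lia.
- by split; lia.
Qed.

Let left_noncrossing : noncrossing left_steps.
Proof.
rewrite !noncrossing_cat noncrossing1 (proj1 left_zig) (proj1 left_run) !andbT.
rewrite apart_catr -andbA; apply/and3P; split; apply: apartP => e f.
- move=> /left_zig_bounds[h1 h2 h3 h4 h5] /left_run_bounds[f1 f2 [f3 f4]].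
  by apply: separatedC; apply: (@separated_x 0); lia.
- move=> /left_zig_bounds[h1 h2 h3 h4 h5]; rewrite mem_seq1 => /eqP ->.
  by apply: (@separated_y N%:Z) => /=; lia.
- move=> /left_run_bounds[f1 f2 [f3 f4]]; rewrite mem_seq1 => /eqP ->.
  by apply: (@separated_x 0) => /=; lia.
Qed.

Let bot_noncrossing : noncrossing bot_steps.
Proof.
rewrite !noncrossing_cat noncrossing1 (proj1 bot_zig) (proj1 bot_run) !andbT.
rewrite apart_catr -andbA; apply/and3P; split; apply: apartP => e f.
- rewrite mem_seq1 => /eqP -> /bot_run_bounds[f1 f2 [f3 f4]].
  by apply: separatedC; apply: (@separated_y 0) => /=; lia.
- rewrite mem_seq1 => /eqP -> /bot_zig_bounds[h1 h2 h3 h4 h5].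
  by apply: separatedC; apply: (@separated_x N%:Z) => /=; lia.
- move=> /bot_run_bounds[f1 f2 [f3 f4]] /bot_zig_bounds[h1 h2 h3 h4 h5].
  by apply: (@separated_y 0) => /=; lia.
Qed.

Lemma tour_noncrossing : noncrossing (pairmap pair (0, 0)%N tour).
Proof.
have snake_b e := @snake_steps_bounds N k1 k2 k1_gt0 k2_gt0 k1N k2N (2 * N - 2) 1 e
  isT ltac:(lia).
rewrite pairmap_tour noncrossing_cat left_noncrossing noncrossing_cat.
rewrite bot_noncrossing snake_steps_noncrossing //; last by lia.
rewrite !andbT apart_catr -andbA; apply/and3P; split; apply: apartP => e f.
- move=> /left_bounds[h1 h2 h3 h4] /snake_b h.
  by apply: (@separated_x 1); lia.
- move=> /left_bounds[h1 h2 h3 h4] /bot_bounds[f1 f2 f3 f4].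
  by apply: (@separated_level 0); lia.
- move=> /snake_b h /bot_bounds[f1 f2 f3 f4].
  by apply: separatedC; apply: (@separated_y 1); lia.
Qed.

Lemma tour_primitive : {in pairmap pair (0, 0)%N tour, forall e, primitive e}.
Proof.
move=> e; rewrite pairmap_tour !mem_cat -!orbA !orFb => /or4P[he|he|/eqP ->|].
- exact: (proj2 left_zig).
- exact: (proj2 left_run).
- by exists 1, 0 => /=; ring.
move=> /or4P[he|/eqP ->|he|he].
- by apply: snake_steps_primitive he => //; lia.
- by exists 0, (-1) => /=; ring.
- exact: (proj2 bot_run).
- exact: (proj2 bot_zig).
Qed.

Lemma tour_cover x y : (x <= N)%N -> (y <= N)%N -> (x, y) \in tour.
Proof.
move=> hx hy.
have lz i : (0 < i <= k1.*2)%N -> leftzig i \in tour.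
  by move=> hi; rewrite /tour mem_cat mem_walk.
have lr i : (0 < i <= N - k1)%N -> leftrun i \in tour.
  by move=> hi; rewrite /tour !mem_cat (mem_walk leftrun hi) orbT.
have br i : (0 < i <= N - k2)%N -> botrun i \in tour.
  by move=> hi; rewrite /tour !(mem_cat, inE) (mem_walk botrun hi) !orbT.
have bz i : (0 < i <= k2.*2)%N -> botzig i \in tour.
  by move=> hi; rewrite /tour !(mem_cat, inE) (mem_walk botzig hi) !orbT.
have [->|x0] := eqVneq x 0%N.
  have [->|y0] := eqVneq y 0%N.
    have -> : (0, 0)%N = botzig k2.*2 by rewrite /botzig zigzag_even subnn.
    by apply: bz; lia.
  case: (leqP y k1) => hyk.
    have -> : (0, y)%N = leftzig y.*2 by rewrite /leftzig zigzag_even.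
    by apply: lz; lia.
  have -> : (0, y)%N = leftrun (y - k1) by rewrite /leftrun; congr pair; lia.
  by apply: lr; lia.
have [->|y0] := eqVneq y 0%N.
  case: (ltnP x k2) => hxk.
    have -> : (x, 0)%N = botzig (k2 - x).*2.
      by rewrite /botzig zigzag_even; congr pair; lia.
    by apply: bz; lia.
  have [->|xN] := eqVneq x N.
    by rewrite /tour !(mem_cat, inE) eqxx !orbT.
  have -> : (x, 0)%N = botrun (N - x) by rewrite /botrun; congr pair; lia.
  by apply: br; lia.
case: (leqP (lo N k1 k2 (x + N - y)) x) => hlo.
  have := @snake_cover N k1 k2 k1_gt0 k2_gt0 k1N k2N x y ltac:(lia) ltac:(lia) hlo.
  rewrite zig_first // /tour !(mem_cat, inE).
  by move=> /orP[->|->]; rewrite !orbT.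
have [[x1 y1]|[y1 x1]] :
    (x = 1 /\ N - k1 <= y < N)%N \/ (y = 1 /\ N - k2 <= x < N)%N.
  by move: hlo; rewrite /lo; repeat (case: ifP => ?); lia.
- have -> : (x, y)%N = leftzig (y - (N - k1)).*2.+1.
    by rewrite /leftzig zigzag_odd; congr pair; lia.
  by apply: lz; lia.
- have -> : (x, y)%N = botzig (N - 1 - x).*2.+1.
    by rewrite /botzig zigzag_odd; congr pair; lia.
  by apply: bz; lia.
Qed.

Lemma size_tour : size tour = (N.+1 ^ 2)%N.
Proof.
have := @size_snake N k1 k2 k1_gt0 k2_gt0 k1N k2N.
rewrite /tour !(size_cat, size_walk) /= !(size_cat, size_walk).
move: (size _) => s; rewrite expr2 -PoszM => h.
have -> : (N.+1 ^ 2 = N * N + 2 * N + 1)%N by rewrite -addn1 sqrnD; lia.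
by rewrite /= size_cat !size_walk; lia.
Qed.

Lemma sum_tour : \sum_(e <- pairmap pair (0, 0)%N tour) sqlen e =
  k1%:Z * (2 + (N%:Z - k1%:Z) ^+ 2 + (N%:Z - k1%:Z - 1) ^+ 2) +
  k2%:Z * (2 + (N%:Z - k2%:Z) ^+ 2 + (N%:Z - k2%:Z - 1) ^+ 2) +
  4 - k1%:Z - k2%:Z +
  (2 * (\sum_(0 <= w < N) gain w.+1) + gain 2%N - gain 1%N - gain k1.+2 -
   gain k2.+1).
Proof.
rewrite pairmap_tour /left_steps /bot_steps !big_cat /= !big_seq1.
rewrite sum_snake_steps //.
rewrite (@sum_steps_zigzag _ _ _ 0 0 1 (N%:Z - k1%:Z) 0 1); last 2 first.
- by move=> j hj /=; split; lia.
- by move=> j hj /=; split; lia.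
rewrite (@sum_steps_line _ _ 0 k1%:Z 0 1); last first.
  by move=> j hj /=; split; lia.
rewrite (@sum_steps_line _ _ N%:Z 0 (-1) 0); last first.
  by move=> j hj /=; split; lia.
rewrite (@sum_steps_zigzag _ _ _ k2%:Z 0 (N%:Z - 1) 1 (-1) 0); last 2 first.
- by move=> j hj /=; split; lia.
- by move=> j hj /=; split; lia.
rewrite !uphalf_double !doubleK.
have -> : (N - k1)%N%:Z = N%:Z - k1%:Z by lia.
have -> : (N - k2)%N%:Z = N%:Z - k2%:Z by lia.
by rewrite /sqlen /=; ring.
Qed.

End Tour.

(** * The sum of the squared lengths *)

Definition tour_sum N k1 k2 : int :=
  k1%:Z * (2 + (N%:Z - k1%:Z) ^+ 2 + (N%:Z - k1%:Z - 1) ^+ 2) +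
  k2%:Z * (2 + (N%:Z - k2%:Z) ^+ 2 + (N%:Z - k2%:Z - 1) ^+ 2) +
  4 - k1%:Z - k2%:Z +
  (2 * (\sum_(0 <= w < N) gain w.+1) + gain 2%N - gain 1%N - gain k1.+2 -
   gain k2.+1).

Lemma gain_mod q i : (0 < i <= 3)%N -> gain (3 * q + i)%N =
  (q%:Z + 1) * ((2 * q%:Z + i%:Z - 1) ^+ 2 + (2 * q%:Z + i%:Z - 2) ^+ 2) +
  q%:Z * ((2 * q%:Z + i%:Z) ^+ 2 + (2 * q%:Z + i%:Z - 1) ^+ 2) +
  2 * q%:Z + 2 * i%:Z - 2.
Proof.
move=> hi; have h : third (3 * q + i) = q.+1 by rewrite /third; lia.
by rewrite /gain /zig_sum h intS PoszD PoszM; ring.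
Qed.

Lemma sum_gain3 q : \sum_(0 <= w < 3 * q) gain w.+1 =
  12 * q%:Z ^+ 4 - 2 * q%:Z ^+ 2 + 3 * q%:Z.
Proof.
elim: q => [|q IH]; first by rewrite big_nil; ring.
have -> : (3 * q.+1 = (3 * q).+3)%N by lia.
do 3!rewrite big_nat_recr //; rewrite /= IH.
have -> : (3 * q).+3 = (3 * q + 3)%N by lia.
have -> : (3 * q).+2 = (3 * q + 2)%N by lia.
have -> : (3 * q).+1 = (3 * q + 1)%N by lia.
by rewrite !gain_mod // intS; ring.
Qed.

Lemma sum_gain1 q : \sum_(0 <= w < 3 * q + 1) gain w.+1 =
  12 * q%:Z ^+ 4 + 16 * q%:Z ^+ 3 + 6 * q%:Z ^+ 2 + 3 * q%:Z + 1.
Proof.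
rewrite [in X in index_iota _ X]addn1 big_nat_recr // sum_gain3.
rewrite (_ : (3 * q).+1 = 3 * q + 1)%N ?gain_mod //; last by lia.
by rewrite /=; ring.
Qed.

Lemma sum_gain2 q : \sum_(0 <= w < 3 * q + 2) gain w.+1 =
  12 * q%:Z ^+ 4 + 32 * q%:Z ^+ 3 + 30 * q%:Z ^+ 2 + 15 * q%:Z + 4.
Proof.
have -> : (3 * q + 2 = (3 * q + 1).+1)%N by lia.
rewrite big_nat_recr // sum_gain1.
rewrite (_ : (3 * q + 1).+1 = 3 * q + 2)%N ?gain_mod //; last by lia.
by rewrite /=; ring.
Qed.

Lemma gain_1 : gain 1 = 1.
Proof. by rewrite (_ : 1 = 3 * 0 + 1)%N // gain_mod //; ring. Qed.

Lemma gain_2 : gain 2 = 3.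
Proof. by rewrite (_ : 2 = 3 * 0 + 2)%N // gain_mod //; ring. Qed.

Lemma alpha_mod0 (R : realType) m :
  alpha R (9 * m + 8).+1 =
  (tour_sum (9 * m + 8) (3 * m + 2) (3 * m + 2))%:~R.
Proof.
rewrite /alpha /alpha_residue.
have -> : ((9 * m + 8).+1 %% 9 = 0)%N by lia.
rewrite /tour_sum gain_1 gain_2.
have -> : (9 * m + 8 = 3 * (3 * m + 2) + 2)%N by lia.
have -> : (3 * m + 2).+2 = (3 * (m + 1) + 1)%N by lia.
have -> : (3 * m + 2).+1 = (3 * (m + 0) + 3)%N by lia.
rewrite sum_gain2 (@gain_mod (m + 1) 1 isT) (@gain_mod (m + 0) 3 isT).
by field.
Qed.

Lemma alpha_mod1 (R : realType) m :
  alpha R (9 * m + 9).+1 =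
  (tour_sum (9 * m + 9) (3 * m + 2) (3 * m + 2))%:~R.
Proof.
rewrite /alpha /alpha_residue.
have -> : ((9 * m + 9).+1 %% 9 = 1)%N by lia.
rewrite /tour_sum gain_1 gain_2.
have -> : (9 * m + 9 = 3 * (3 * m + 3))%N by lia.
have -> : (3 * m + 2).+2 = (3 * (m + 1) + 1)%N by lia.
have -> : (3 * m + 2).+1 = (3 * (m + 0) + 3)%N by lia.
rewrite sum_gain3 (@gain_mod (m + 1) 1 isT) (@gain_mod (m + 0) 3 isT).
by field.
Qed.

Lemma alpha_mod2 (R : realType) m :
  alpha R (9 * m + 10).+1 =
  (tour_sum (9 * m + 10) (3 * m + 2) (3 * m + 3))%:~R.
Proof.
rewrite /alpha /alpha_residue.
have -> : ((9 * m + 10).+1 %% 9 = 2)%N by lia.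
rewrite /tour_sum gain_1 gain_2.
have -> : (9 * m + 10 = 3 * (3 * m + 3) + 1)%N by lia.
have -> : (3 * m + 2).+2 = (3 * (m + 1) + 1)%N by lia.
have -> : (3 * m + 3).+1 = (3 * (m + 1) + 1)%N by lia.
rewrite sum_gain1 (@gain_mod (m + 1) 1 isT).
by field.
Qed.

Lemma alpha_mod3 (R : realType) m :
  alpha R (9 * m + 11).+1 =
  (tour_sum (9 * m + 11) (3 * m + 3) (3 * m + 3))%:~R.
Proof.
rewrite /alpha /alpha_residue.
have -> : ((9 * m + 11).+1 %% 9 = 3)%N by lia.
rewrite /tour_sum gain_1 gain_2.
have -> : (9 * m + 11 = 3 * (3 * m + 3) + 2)%N by lia.
have -> : (3 * m + 3).+2 = (3 * (m + 1) + 2)%N by lia.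
have -> : (3 * m + 3).+1 = (3 * (m + 1) + 1)%N by lia.
rewrite sum_gain2 (@gain_mod (m + 1) 2 isT) (@gain_mod (m + 1) 1 isT).
by field.
Qed.

Lemma alpha_mod4 (R : realType) m :
  alpha R (9 * m + 12).+1 =
  (tour_sum (9 * m + 12) (3 * m + 3) (3 * m + 3))%:~R.
Proof.
rewrite /alpha /alpha_residue.
have -> : ((9 * m + 12).+1 %% 9 = 4)%N by lia.
rewrite /tour_sum gain_1 gain_2.
have -> : (9 * m + 12 = 3 * (3 * m + 4))%N by lia.
have -> : (3 * m + 3).+2 = (3 * (m + 1) + 2)%N by lia.
have -> : (3 * m + 3).+1 = (3 * (m + 1) + 1)%N by lia.
rewrite sum_gain3 (@gain_mod (m + 1) 2 isT) (@gain_mod (m + 1) 1 isT).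
by field.
Qed.

Lemma alpha_mod5 (R : realType) m :
  alpha R (9 * m + 13).+1 =
  (tour_sum (9 * m + 13) (3 * m + 3) (3 * m + 4))%:~R.
Proof.
rewrite /alpha /alpha_residue.
have -> : ((9 * m + 13).+1 %% 9 = 5)%N by lia.
rewrite /tour_sum gain_1 gain_2.
have -> : (9 * m + 13 = 3 * (3 * m + 4) + 1)%N by lia.
have -> : (3 * m + 3).+2 = (3 * (m + 1) + 2)%N by lia.
have -> : (3 * m + 4).+1 = (3 * (m + 1) + 2)%N by lia.
rewrite sum_gain1 (@gain_mod (m + 1) 2 isT).
by field.
Qed.

Lemma alpha_mod6 (R : realType) m :
  alpha R (9 * m + 14).+1 =
  (tour_sum (9 * m + 14) (3 * m + 4) (3 * m + 4))%:~R.
Proof.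
rewrite /alpha /alpha_residue.
have -> : ((9 * m + 14).+1 %% 9 = 6)%N by lia.
rewrite /tour_sum gain_1 gain_2.
have -> : (9 * m + 14 = 3 * (3 * m + 4) + 2)%N by lia.
have -> : (3 * m + 4).+2 = (3 * (m + 1) + 3)%N by lia.
have -> : (3 * m + 4).+1 = (3 * (m + 1) + 2)%N by lia.
rewrite sum_gain2 (@gain_mod (m + 1) 3 isT) (@gain_mod (m + 1) 2 isT).
by field.
Qed.

Lemma alpha_mod7 (R : realType) m :
  alpha R (9 * m + 15).+1 =
  (tour_sum (9 * m + 15) (3 * m + 4) (3 * m + 4))%:~R.
Proof.
rewrite /alpha /alpha_residue.
have -> : ((9 * m + 15).+1 %% 9 = 7)%N by lia.
rewrite /tour_sum gain_1 gain_2.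
have -> : (9 * m + 15 = 3 * (3 * m + 5))%N by lia.
have -> : (3 * m + 4).+2 = (3 * (m + 1) + 3)%N by lia.
have -> : (3 * m + 4).+1 = (3 * (m + 1) + 2)%N by lia.
rewrite sum_gain3 (@gain_mod (m + 1) 3 isT) (@gain_mod (m + 1) 2 isT).
by field.
Qed.

Lemma alpha_mod8 (R : realType) m :
  alpha R (9 * m + 16).+1 =
  (tour_sum (9 * m + 16) (3 * m + 4) (3 * m + 5))%:~R.
Proof.
rewrite /alpha /alpha_residue.
have -> : ((9 * m + 16).+1 %% 9 = 8)%N by lia.
rewrite /tour_sum gain_1 gain_2.
have -> : (9 * m + 16 = 3 * (3 * m + 5) + 1)%N by lia.
have -> : (3 * m + 4).+2 = (3 * (m + 1) + 3)%N by lia.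
have -> : (3 * m + 5).+1 = (3 * (m + 1) + 3)%N by lia.
rewrite sum_gain1 (@gain_mod (m + 1) 3 isT).
by field.
Qed.

Lemma tour_bound (R : realType) N k1 k2 :
  (0 < k1)%N -> (0 < k2)%N -> (k1 + 3 <= N)%N -> (k2 + 3 <= N)%N ->
  (tour_sum N k1 k2)%:~R <= max_sum_sq_lengths R N.+1.
Proof.
move=> h1 h2 h3 h4; rewrite /tour_sum -sum_tour //.
apply: le_max_sum_sq_lengths (lexx _).
- exact: last_tour.
- by rewrite size_tour.
- by move=> x y; rewrite !ltnS; exact: tour_cover.
- exact: tour_noncrossing.
- exact: tour_primitive.
Qed.

Theorem mainTheorem1 (R : realType) (n : nat) (hn : (9 <= n)%N) :
  alpha R n <= max_sum_sq_lengths R n.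
Proof.
have : (n %% 9 < 9)%N by rewrite ltn_mod.
have : n = (9 * (n %/ 9).-1 + (8 + n %% 9)).+1 by lia.
move: (n %/ 9).-1 (n %% 9)%N => m r -> {hn}.
case: r => [|[|[|[|[|[|[|[|[|//]]]]]]]]] _.
- by rewrite alpha_mod0; apply: tour_bound; lia.
- by rewrite alpha_mod1; apply: tour_bound; lia.
- by rewrite alpha_mod2; apply: tour_bound; lia.
- by rewrite alpha_mod3; apply: tour_bound; lia.
- by rewrite alpha_mod4; apply: tour_bound; lia.
- by rewrite alpha_mod5; apply: tour_bound; lia.
- by rewrite alpha_mod6; apply: tour_bound; lia.
- by rewrite alpha_mod7; apply: tour_bound; lia.
- by rewrite alpha_mod8; apply: tour_bound; lia.
Qed.
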